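(* Let $A\in\mathbb{R}^{n\times n}$ be symmetric positive definite and $H\in\mathbb{R}^{n\times n}$. Let $\tilde y$ be the projection of $y\in\mathbb{R}^n$ onto $\ker(H-A^{-1})^{\perp_{A^{-1}}}$ (orthogonal with respect to $\langle\cdot,\cdot\rangle_{A^{-1}}$), and assume $\tilde y\ne0$. Then $$\frac{\|A^{1/2}(H-A^{-1})y\|_2^2}{\|A^{-1/2}y\|_2^2}\le\frac{\|A^{1/2}(H-A^{-1})\tilde y\|_2^2}{\|A^{-1/2}\tilde y\|_2^2},$$ with equality if and only if $y\in\ker(H-A^{-1})^{\perp_{A^{-1}}}$.
   Context: $\langle a,b\rangle_{A^{-1}}=a^\top A^{-1}b$; for a subspace $V\subseteq\mathbb{R}^n$, $V^{\perp_{A^{-1}}}=\{z:\langle z,x\rangle_{A^{-1}}=0\ \forall x\in V\}$, and projection onto it means the orthogonal projection with respect to $\langle\cdot,\cdot\rangle_{A^{-1}}$. $A^{1/2}$ is the symmetric positive definite square root of $A$ and $A^{-1/2}$ its inverse. *)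

(* Defs.v *)
From mathcomp Require Import all_boot all_order all_algebra.
From mathcomp Require Import boolp classical_sets reals.

Set Implicit Arguments.
Unset Strict Implicit.
Unset Printing Implicit Defensive.

Import Order.TTheory GRing.Theory Num.Theory.

Local Open Scope classical_set_scope.
Local Open Scope ring_scope.

Definition norm2 (R : realType) (n : nat) (v : 'cV[R]_n) : R :=
  Num.sqrt (\sum_(i < n) v i 0 ^+ 2).

(* 'M[R]_1 is identified with R through its only entry. *)
Definition innermx (R : realType) (n : nat) (M : 'M[R]_n) (a b : 'cV[R]_n) : R :=
  (a^T *m M *m b) 0 0.

Definition spdmx (R : realType) (n : nat) (M : 'M[R]_n) : Prop :=
  M^T = M /\ forall x : 'cV[R]_n, x != 0 -> 0 < innermx M x x.

(* For A symmetric positive definite the set below is a singleton; the default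
   value 0 is only returned when A has no such square root. *)
Definition sqrtmx (R : realType) (n : nat) (A : 'M[R]_n) : 'M[R]_n :=
  xget 0 [set S : 'M[R]_n | spdmx S /\ S *m S = A].

(* Right kernel, acting on column vectors; the library's kermx is the left
   kernel, acting on row vectors. *)
Definition rkermx (R : realType) (n : nat) (B : 'M[R]_n) : set 'cV[R]_n :=
  [set x | B *m x = 0].

Definition perpmx (R : realType) (n : nat) (M : 'M[R]_n) (V : set 'cV[R]_n) :
    set 'cV[R]_n :=
  [set z | forall x, V x -> innermx M z x = 0].

(* Orthogonal projection of y onto W for the inner product of M: the p in W
   with y - p orthogonal to W. For M symmetric positive definite and W a linear
   subspace there is exactly one such p, so the default value 0 plays no role. *)
Definition oprojmx (R : realType) (n : nat) (M : 'M[R]_n) (W : set 'cV[R]_n)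
    (y : 'cV[R]_n) : 'cV[R]_n :=
  xget 0 [set p | W p /\ perpmx M W (y - p)].

(* Main.v *)
(* Write B = H - A^-1 and y = yt + k with k in ker B. Both quotients have the
   same numerator, since B y = B yt, and it is nonzero because ker B meets its
   orthogonal complement trivially. The denominators are |y|^2 and |yt|^2 for
   the inner product of A^-1, so by Pythagoras they differ by |k|^2, which
   vanishes exactly when y = yt. For the existence of
   A^{1/2}, A is diagonalized over R[i] with positive real eigenvalues, and
   the root is a real polynomial in A interpolating the roots of these. *)
Require Import Defs.
From mathcomp Require Import all_boot all_order all_algebra.
From mathcomp Require Import boolp classical_sets reals.
From mathcomp Require Import complex.

Set Implicit Arguments.
Unset Strict Implicit.
Unset Printing Implicit Defensive.

Import Order.TTheory GRing.Theory Num.Theory.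

Local Open Scope classical_set_scope.
Local Open Scope ring_scope.

(** * Bilinear forms and positive definite matrices *)

Lemma innermxDl (R : realType) (n : nat) (M : 'M[R]_n) (a b c : 'cV[R]_n) :
  innermx M (a + b) c = innermx M a c + innermx M b c.
Proof. by rewrite /innermx linearD /= !mulmxDl mxE. Qed.

Lemma innermxDr (R : realType) (n : nat) (M : 'M[R]_n) (a b c : 'cV[R]_n) :
  innermx M a (b + c) = innermx M a b + innermx M a c.
Proof. by rewrite /innermx mulmxDr mxE. Qed.

Lemma innermxNl (R : realType) (n : nat) (M : 'M[R]_n) (a b : 'cV[R]_n) :
  innermx M (- a) b = - innermx M a b.
Proof. by rewrite /innermx linearN /= !mulNmx mxE. Qed.

Lemma innermx0 (R : realType) (n : nat) (M : 'M[R]_n) (a : 'cV[R]_n) :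
  innermx M a 0 = 0.
Proof. by rewrite /innermx mulmx0 mxE. Qed.

Lemma innermxC (R : realType) (n : nat) (M : 'M[R]_n) (a b : 'cV[R]_n) :
  M^T = M -> innermx M a b = innermx M b a.
Proof.
move=> Msym; rewrite /innermx -[in LHS](trmxK (a^T *m M *m b)) mxE.
by rewrite !trmx_mul trmxK Msym mulmxA.
Qed.

Lemma norm2_sqr (R : realType) (n : nat) (v : 'cV[R]_n) :
  norm2 v ^+ 2 = (v^T *m v) 0 0.
Proof.
rewrite /norm2 sqr_sqrtr; last by apply: sumr_ge0 => i _; rewrite sqr_ge0.
by rewrite mxE; apply: eq_bigr => i _; rewrite mxE expr2.
Qed.

Lemma norm2_sqr_gt0 (R : realType) (n : nat) (v : 'cV[R]_n) :
  v != 0 -> 0 < norm2 v ^+ 2.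
Proof.
move=> v0; rewrite lt_def sqr_ge0 andbT; apply: contra_neq v0 => /eqP.
rewrite norm2_sqr mxE psumr_eq0 => [/allP h|i _]; last first.
  by rewrite mxE -expr2 sqr_ge0.
apply/colP => i; have := h i (mem_index_enum _).
by rewrite !mxE -expr2 sqrf_eq0 => /eqP.
Qed.

Lemma spdmx_ge0 (R : realType) (n : nat) (M : 'M[R]_n) (x : 'cV[R]_n) :
  spdmx M -> 0 <= innermx M x x.
Proof.
by move=> [_ Mpos]; have [->|/Mpos/ltW//] := eqVneq x 0; rewrite innermx0.
Qed.

Lemma spdmx_eq0 (R : realType) (n : nat) (M : 'M[R]_n) (x : 'cV[R]_n) :
  spdmx M -> innermx M x x = 0 -> x = 0.
Proof.
by move=> [_ Mpos] x0; apply/eqP/negP => /negP/Mpos; rewrite x0 ltxx.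
Qed.

(** A row [v] with [v *m M = 0] would satisfy $v M v^\top = 0$, which definiteness excludes unless
    [v] is zero. *)
Lemma spdmx_unit (R : realType) (n : nat) (M : 'M[R]_n) :
  spdmx M -> M \in unitmx.
Proof.
move=> Mspd; rewrite -row_free_unit; apply: inj_row_free => v vM.
have: v^T = 0 by apply: (spdmx_eq0 Mspd); rewrite /innermx trmxK vM mul0mx mxE.
by move/(congr1 trmx); rewrite trmxK trmx0.
Qed.

Lemma spdmx_inv (R : realType) (n : nat) (M : 'M[R]_n) :
  spdmx M -> spdmx (invmx M).
Proof.
move=> Mspd; have Mu := spdmx_unit Mspd; have [Msym Mpos] := Mspd.
split=> [|x x0]; first by rewrite trmx_inv Msym.
have -> : innermx (invmx M) x x = innermx M (invmx M *m x) (invmx M *m x).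
  by rewrite /innermx trmx_mul trmx_inv Msym mulmxA mulmxKV.
apply: Mpos; apply: contra_neq x0 => /(congr1 (mulmx M)).
by rewrite mulKVmx // mulmx0.
Qed.

(** * Existence of the square root *)

Lemma interpolation (F : fieldType) (f : F -> F) (s : seq F) :
  exists p : {poly F}, {in s, forall x, p.[x] = f x}.
Proof.
elim: s => [|x s [p ps]]; first by exists 0.
have [xs|xs] := boolP (x \in s).
  by exists p => z; rewrite inE => /predU1P[->|]; apply: ps.
(* [q] vanishes at the old nodes, so adding a multiple of it keeps their values; it is nonzero at
   the new node [x], which is not among them. *)
pose q := \prod_(z <- s) ('X - z%:P).
exists (p + ((f x - p.[x]) / q.[x])%:P * q) => z.
rewrite !hornerE inE => /predU1P[->|zs].
  rewrite divfK; first by rewrite addrC subrK.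
  by rewrite -/(root q x) root_prod_XsubC.
have /rootP -> : root q z by rewrite root_prod_XsubC.
by rewrite mulr0 addr0 ps.
Qed.

(** Transposition reverses the product $p(A)A$ in the induction, but its factors commute. *)
Lemma horner_mx_sym (R : comNzRingType) (n : nat) (A : 'M[R]_n.+1)
    (p : {poly R}) : A^T = A -> (horner_mx A p)^T = horner_mx A p.
Proof.
move=> Asym; elim/poly_ind: p => [|p c IH]; first by rewrite rmorph0 trmx0.
rewrite rmorphD rmorphM /= horner_mx_X horner_mx_C linearD /= tr_scalar_mx.
by rewrite trmx_mul IH Asym; congr (_ + _); apply: comm_mx_horner.
Qed.

Lemma spdmx_diag (R : realType) (n : nat) (A : 'M[R]_n) : spdmx A ->
  exists (P : 'M[R[i]]_n) (e : 'rV[R]_n),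
    [/\ P \in unitmx, forall i, 0 < e 0 i &
        map_mx (real_complex R) A
          = invmx P *m diag_mx (map_mx (real_complex R) e) *m P].
Proof.
move=> [Asym Apos]; set AC := map_mx _ A.
have ACreal : AC \is a mxOver Num.real.
  by apply/mxOverP => i j; rewrite mxE; apply/complex_realP; exists (A i j).
have ACherm : AC \is hermsymmx.
  apply: realsym_hermsym => //; apply/is_hermitianmxP.
  by rewrite scale1r map_mx_id // map_trmx Asym.
have /orthomx_spectralP := hermitian_normalmx ACherm.
have Pu := spectral_unit AC.
have /mxOverP dreal := hermitian_spectral_diag_real ACherm.
move: (spectralmx AC) (spectral_diag AC) Pu dreal => P d Pu dreal ACE.
pose e := \row_i complex.Re (d 0 i).
have dE : map_mx (real_complex R) e = d.
  by apply/rowP => i; rewrite !mxE RRe_real.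
exists P, e; split=> [|i|]; [exact: Pu| |by rewrite dE].
(* Writing $D$ for the diagonal matrix, $P A = D P$, so row [i] of [P] is a left eigenvector. *)
have: eigenvalue AC (real_complex R (e 0 i)).
  apply/eigenvalueP; exists (row i P).
    rewrite ACE -row_mul mulmxA mulKVmx // row_mul row_diag_mx.
    by rewrite -scalemxAl -rowE -dE mxE.
  apply/eqP => /(congr1 (mulmx^~ (invmx P))).
  rewrite -row_mul mulmxV // mul0mx => /rowP/(_ i)/eqP.
  by rewrite !mxE eqxx oner_eq0.
(* A real eigenvalue of the complexified matrix already has a real eigenvector [v], and $0 < v A
   v^\top = e_i |v|^2$ gives its sign. *)
rewrite eigenvalue_map => /eigenvalueP[v vA v0].
have vT0 : v^T != 0 by rewrite -(trmx0 R) (inj_eq trmx_inj).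
have := Apos _ vT0; rewrite /innermx trmxK vA -scalemxAl mxE.
by rewrite -{1}[v]trmxK -norm2_sqr pmulr_lgt0 // norm2_sqr_gt0.
Qed.

(* Taking T as a fourth root makes S = T^2 positive for free:
   x^T S x = |T x|^2. *)
Lemma spdmx_sqrt (R : realType) (n : nat) (A : 'M[R]_n) :
  spdmx A -> exists S : 'M[R]_n, spdmx S /\ S *m S = A.
Proof.
(* Polynomials are evaluated only at matrices of positive size; in size 0 all matrices coincide. *)
case: n A => [|n] A Aspd; first by exists A; split=> //; rewrite [LHS]flatmx0 [RHS]flatmx0.
have [P [e [Pu epos AE]]] := spdmx_diag Aspd.
have [p pE] := interpolation (fun x => Num.sqrt (Num.sqrt x)) (codom (e 0)).
set T := horner_mx A p.
have T4 : T ^+ 4 = A.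
  (* The identity is checked over [R[i]], where evaluating a polynomial at [A] amounts to evaluating
     it at each eigenvalue. *)
  apply: (@map_mx_inj _ _ (real_complex R)).
  rewrite -rmorphXn /= map_horner_mx AE horner_mx_uconjC //.
  rewrite horner_mx_diag; congr (_ *m diag_mx _ *m _).
  apply/rowP => i; rewrite !mxE horner_map; congr (real_complex R _).
  rewrite horner_exp pE ?codom_f // (exprM _ 2 2).
  by rewrite !sqr_sqrtr ?sqrtr_ge0 // ltW.
have TT : T^T = T by apply: horner_mx_sym; case: Aspd.
have Tu : T \in unitmx.
  by have := spdmx_unit Aspd; rewrite -T4 exprS unitmx_mul => /andP[].
exists (T *m T); split; last first.
  by rewrite -[RHS]T4 (exprD _ 2 2) !expr2.
split=> [|x x0]; first by rewrite trmx_mul TT.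
have -> : innermx (T *m T) x x = norm2 (T *m x) ^+ 2.
  by rewrite norm2_sqr /innermx trmx_mul TT !mulmxA.
apply: norm2_sqr_gt0; apply: contra_neq x0 => /(congr1 (mulmx (invmx T))).
by rewrite mulKmx // mulmx0.
Qed.

Lemma sqrtmxP (R : realType) (n : nat) (A : 'M[R]_n) :
  spdmx A -> spdmx (sqrtmx A) /\ sqrtmx A *m sqrtmx A = A.
Proof.
move=> /spdmx_sqrt[S hS].
exact: (xgetPex 0 (P := [set S | spdmx S /\ S *m S = A]) (ex_intro _ S hS)).
Qed.

Lemma norm2_invsqrtmx (R : realType) (n : nat) (A : 'M[R]_n) (x : 'cV[R]_n) :
  spdmx A -> norm2 (invmx (sqrtmx A) *m x) ^+ 2 = innermx (invmx A) x x.
Proof.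
move=> /sqrtmxP[Sspd SE]; have Su := spdmx_unit Sspd; have [Ssym _] := Sspd.
rewrite norm2_sqr /innermx trmx_mul trmx_inv Ssym -{3}SE.
have -> : invmx (sqrtmx A *m sqrtmx A)
          = invmx (sqrtmx A) *m invmx (sqrtmx A).
  apply: (can_inj (mulKmx (_ : sqrtmx A *m sqrtmx A \in unitmx))).
    by rewrite unitmx_mul Su.
  by rewrite mulmxV ?unitmx_mul ?Su // mulmxA mulmxK // mulmxV.
by rewrite !mulmxA.
Qed.

(* With the rows of G a basis of the kernel, the Gram matrix G M G^T is
   invertible and k = G^T (G M G^T)^-1 G M y is the component of y in it. *)
Lemma perp_decomp (R : realType) (n : nat) (M B : 'M[R]_n) (y : 'cV[R]_n) :
  spdmx M -> exists k, rkermx B k /\ perpmx M (rkermx B) (y - k).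
Proof.
move=> Mspd; have [Msym _] := Mspd.
pose G := row_base (kermx B^T).
have BG : B *m G^T = 0.
  apply: trmx_inj; rewrite trmx_mul trmxK trmx0.
  by apply/sub_kermxP; rewrite eq_row_base.
(* If [v] kills the Gram matrix, then $G^\top v^\top$ has zero [M]-norm, so it vanishes, and [v] is
   zero because the rows of [G] are independent. *)
have Gu : G *m M *m G^T \in unitmx.
  rewrite -row_free_unit; apply: inj_row_free => v vG.
  have: G^T *m v^T = 0.
    apply: (spdmx_eq0 Mspd); rewrite /innermx trmx_mul !trmxK.
    have -> : v *m G *m M *m (G^T *m v^T) = v *m (G *m M *m G^T) *m v^T.
      by rewrite !mulmxA.
    by rewrite vG mul0mx mxE.
  move/(congr1 trmx); rewrite trmx_mul !trmxK trmx0 => /eqP.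
  by rewrite mulmx_free_eq0 ?row_base_free // => /eqP.
exists (G^T *m (invmx (G *m M *m G^T) *m (G *m M *m y))); split.
  by rewrite /rkermx /= mulmxA BG mul0mx.
move=> x Bx; rewrite innermxC //.
have /submxP[c xE] : (x^T <= G)%MS.
  rewrite eq_row_base; apply/sub_kermxP.
  by rewrite -trmx_mul Bx trmx0.
set w := invmx _ *m _.
have gramw : G *m M *m G^T *m w = G *m M *m y by rewrite mulKVmx.
have -> : innermx M x (y - G^T *m w)
    = (c *m (G *m M *m y - G *m M *m G^T *m w)) 0 0.
  by rewrite /innermx xE !mulmxBr !mulmxA.
by rewrite gramw subrr mulmx0 mxE.
Qed.

Lemma rkermx_perp0 (R : realType) (n : nat) (M B : 'M[R]_n) (x : 'cV[R]_n) :
  spdmx M -> rkermx B x -> perpmx M (rkermx B) x -> x = 0.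
Proof. by move=> Mspd Bx Wx; apply: (spdmx_eq0 Mspd); apply: Wx. Qed.

(** The definition only puts the residual in the complement of [W]. That it lies in $\ker B$ follows
    from uniqueness: the vector [y - k] of [perp_decomp] is also a projection, and the difference of
    two projections lies in [W] and is orthogonal to [W]. *)
Lemma oprojmx_perp (R : realType) (n : nat) (M B : 'M[R]_n) (y : 'cV[R]_n) :
  spdmx M ->
  let W := perpmx M (rkermx B) in
  W (oprojmx M W y) /\ rkermx B (y - oprojmx M W y).
Proof.
move=> Mspd W; have [Msym _] := Mspd.
have [k [Bk Wyk]] := perp_decomp B y Mspd.
have WB a b : W a -> W b -> W (a - b).
  by move=> Wa Wb x Bx; rewrite innermxDl innermxNl Wa // Wb // subrr.
have kperp : perpmx M W (y - (y - k)).
  by move=> z Wz; rewrite opprB addrC subrK innermxC //; apply: Wz.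
have [Wp pperp] :=
  xgetPex 0 (P := [set p | W p /\ perpmx M W (y - p)])
    (ex_intro _ (y - k) (conj Wyk kperp)).
rewrite -/(oprojmx M W y) in Wp pperp *.
split=> //; suff -> : oprojmx M W y = y - k by rewrite opprB addrC subrK.
have Wd := WB _ _ Wp Wyk.
apply/eqP; rewrite -subr_eq0; apply/eqP/(spdmx_eq0 Mspd).
have {1}-> : oprojmx M W y - (y - k)
    = (y - (y - k)) - (y - oprojmx M W y).
  by rewrite (opprB y (oprojmx M W y)) [RHS]addrC subrKA.
by rewrite innermxDl innermxNl kperp // pperp // subrr.
Qed.

Theorem corollary3p19 (R : realType) (n : nat) (A H : 'M[R]_n) (y : 'cV[R]_n) :
  spdmx A ->
  let B := H - invmx A in
  let W := perpmx (invmx A) (rkermx B) in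
  let yt := oprojmx (invmx A) W y in
  yt != 0 ->
  let lhs := norm2 (sqrtmx A *m B *m y) ^+ 2
             / norm2 (invmx (sqrtmx A) *m y) ^+ 2 in
  let rhs := norm2 (sqrtmx A *m B *m yt) ^+ 2
             / norm2 (invmx (sqrtmx A) *m yt) ^+ 2 in
  lhs <= rhs /\ (lhs = rhs <-> W y).
Proof.
move=> Aspd B W yt yt0 lhs rhs.
have Mspd := spdmx_inv Aspd; have [Msym Mpos] := Mspd.
have [Wyt Bk] := oprojmx_perp B y Mspd; rewrite -/W -/yt in Wyt Bk.
have [k kE] : exists k, k = y - yt by exists (y - yt).
rewrite -kE in Bk; have yE : y = yt + k by rewrite kE addrC subrK.
have numE : sqrtmx A *m B *m y = sqrtmx A *m B *m yt.
  by rewrite yE mulmxDr -[_ *m k]mulmxA Bk mulmx0 addr0.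
have numpos : 0 < norm2 (sqrtmx A *m B *m yt) ^+ 2.
  apply: norm2_sqr_gt0; apply: contra_neq yt0.
  have Su := spdmx_unit (sqrtmxP Aspd).1.
  rewrite -mulmxA => /(congr1 (mulmx (invmx (sqrtmx A)))).
  rewrite mulKmx // mulmx0 => Byt; exact: (rkermx_perp0 Mspd Byt).
have denE : innermx (invmx A) y y
            = innermx (invmx A) yt yt + innermx (invmx A) k k.
  rewrite yE !innermxDl !innermxDr [innermx _ k yt]innermxC //.
  by rewrite (Wyt k Bk) addr0 add0r.
have ytpos := Mpos _ yt0; have k_ge0 := spdmx_ge0 k Mspd.
have ypos : 0 < innermx (invmx A) y y by rewrite denE ltr_wpDr.
rewrite /lhs /rhs numE !norm2_invsqrtmx //; split.
  by rewrite ler_pM2l // lef_pV2 ?posrE // denE lerDl.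
split=> [/(mulfI (lt0r_neq0 numpos))/invr_inj|Wy].
  rewrite denE -[RHS]addr0 => /addrI/(spdmx_eq0 Mspd) k0.
  by rewrite yE k0 addr0.
(* For [y] in [W], the vector [k] is a difference of elements of [W] and lies in $\ker B$, hence is
   zero. *)
suff -> : y = yt by [].
rewrite yE (_ : k = 0) ?addr0 //; apply: (rkermx_perp0 Mspd Bk).
by move=> x Bx; rewrite kE innermxDl innermxNl Wy // Wyt // subrr.
Qed.
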